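(* Let $a_1,\dots,a_n$ be integers different from zero. Let $P(a_1,\dots,a_n)$ be a pretzel diagram of a pretzel link $L$. Suppose that: 1. $a_l\neq1$ for any $l\in\{1,\dots,n\}$. 2. There exists $i\in\{1,\dots,n\}$ such that $a_i\ge3$. 3. There are $j,k\in\{1,\dots,n\}$, $j\ne k$, such that $a_j,a_k<0$. Then there are at least $$\prod_{l\,:\,a_l>0}\left\lfloor\frac{a_l}{2}\right\rfloor-1$$ different torsion subgroups $\mathbb Z_2$ in the Khovanov homology of $L$.
   Context: Khovanov homology is the integral (bigraded) Khovanov homology $\bigoplus_{h,q}Kh^{h,q}(L)$, and $\mathbb Z_2=\mathbb Z/2\mathbb Z$. $P(a_1,\dots,a_n)$ is the standard pretzel diagram: $n$ vertical columns, each made of two vertical strands twisted around each other with $|a_l|$ crossings, consecutive columns (cyclically) joined at top and bottom in the usual way. Sign convention: a column with $a_l>0$ has its crossings such that the $A$-smoothing of each of them gives two vertical arcs (the $A$-smoothing joins the two regions swept by rotating the overstrand counterclockwise); in a column with $a_l<0$ the crossings are the opposite ones, i.e. the $B$-smoothing of each of them gives two vertical arcs. *)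

(* Defs.v *)
From HB Require Import structures.
From mathcomp Require Import all_boot all_order all_algebra.
From mathcomp Require Import boolp classical_sets.

Set Implicit Arguments.
Unset Strict Implicit.
Unset Printing Implicit Defensive.

Import GRing.Theory.
Local Open Scope ring_scope.

(* A corner (east, north) of a crossing drawn as an X: the crossing has four
   corners SW, SE, NW, NE, where the boolean "true" means east, resp. north. *)
Definition corner : finType := (bool * bool)%type.

Definition NW : corner := (false, true).
Definition NE : corner := (true, true).
Definition SE : corner := (true, false).

Definition opp_corner (c : corner) : corner := (~~ c.1, ~~ c.2).

(* A link diagram without crossingless components. Every crossing is rotated so
   as to look like an X; over_slash i tells whether its overstrand is the
   diagonal SW-NE (otherwise it is NW-SE). The arcs of the diagram that join the
   crossings are given by the involution glue of the set of all corners.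
   Planarity is not part of the structure: virtual diagrams are allowed. *)
Record diagram := Diagram {
  crossing : finType;
  over_slash : crossing -> bool;
  glue : crossing * corner -> crossing * corner;
  glueK : involutive glue;
  glue_neq : forall d, glue d != d }.

Notation dart D := (crossing D * corner)%type.

Section Khovanov.
Variable D : diagram.

(* A state is the set S of the crossings that receive a B-smoothing. Rotating
   the overstrand SW-NE counterclockwise sweeps the top and the bottom regions,
   so that the A-smoothing of such a crossing consists of two vertical arcs; the
   other three cases follow by symmetry. *)
Definition vertical (S : {set crossing D}) (i : crossing D) : bool :=
  over_slash i != (i \in S).

Definition smooth (S : {set crossing D}) (d : dart D) : dart D :=
  let: (i, (x, y)) := d in
  if vertical S i then (i, (x, ~~ y)) else (i, (~~ x, y)).

Definition adjacent (S : {set crossing D}) : rel (dart D) :=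
  fun d e => (e == glue d) || (e == smooth S d).

Definition circle (S : {set crossing D}) (d : dart D) : {set dart D} :=
  [set e | connect (adjacent S) d e].

Definition circles (S : {set crossing D}) : {set {set dart D}} :=
  [set circle S d | d : dart D].

(* An enhanced state is a pair (S, P), where P is the set of the circles of S
   that are labelled 1; the other circles are labelled x. Enhanced states form
   the standard basis of the tensor powers of Z[x]/(x^2). *)
Definition enhanced : finType :=
  {sp : {set crossing D} * {set {set dart D}} | sp.2 \subset circles sp.1}.

Definition Bset (s : enhanced) : {set crossing D} := (val s).1.
Definition plus (s : enhanced) : {set {set dart D}} := (val s).2.

Definition label_degree (s : enhanced) : int :=
  #|plus s|%:Z - #|circles (Bset s) :\: plus s|%:Z.

Definition touches (i : crossing D) (C : {set dart D}) : bool :=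
  [exists c : corner, (i, c) \in C].

(* Structure constants of Z[x]/(x^2), where true stands for 1 and false for x:
   is the third (resp. first) label a term of the product of the first two
   (resp. is the tensor product of the last two a term of the coproduct)? *)
Definition mul_term (p q r : bool) : bool := (p || q) && (r == p && q).
Definition comul_term (p q r : bool) : bool :=
  if p then q != r else ~~ q && ~~ r.

(* Whether t is a term of the image of s when the smoothing at i changes from A
   to B. The corners NW and SE always lie on different arcs of a smoothed
   crossing. A circle of one state that does not touch i is also a circle of the
   other state. The case of one circle giving one circle is impossible for
   planar diagrams (the map is zero then). *)
Definition surgery (i : crossing D) (s t : enhanced) : bool :=
  let c1 := circle (Bset s) (i, NW) in let c2 := circle (Bset s) (i, SE) in
  let e1 := circle (Bset t) (i, NW) in let e2 := circle (Bset t) (i, SE) in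
  [&& i \notin Bset s, Bset t == i |: Bset s,
      [set C in plus s | ~~ touches i C] == [set C in plus t | ~~ touches i C]
    & if c1 != c2 then mul_term (c1 \in plus s) (c2 \in plus s) (e1 \in plus t)
      else (e1 != e2) &&
           comul_term (c1 \in plus s) (e1 \in plus t) (e2 \in plus t)].

Definition edge_sign (S : {set crossing D}) (i : crossing D) : int :=
  (-1) ^+ #|[set j in S | (enum_rank j < enum_rank i)%N]|.

Definition incidence (s t : enhanced) : int :=
  \sum_(i | surgery i s t) edge_sign (Bset s) i.

Definition chain : zmodType := {ffun enhanced -> int}.

Definition differential (f : chain) : chain :=
  [ffun t => \sum_s incidence s t * f s].

(* out d holds when the strand through the corner d is directed away from the
   crossing there. *)
Record orientation := Orientation {
  out : dart D -> bool;
  out_glue : forall d, out (glue d) = ~~ out d;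
  out_opp : forall i c, out (i, opp_corner c) = ~~ out (i, c) }.

Variable o : orientation.

(* If NW and NE are both outgoing (or both incoming), then the crossing is
   positive exactly when the overstrand is SW-NE; otherwise turn the picture by
   a right angle. *)
Definition positive (i : crossing D) : bool :=
  over_slash i == (out o (i, NW) == out o (i, NE)).

Definition n_plus : nat := #|[set i | positive i]|.
Definition n_minus : nat := #|[set i | ~~ positive i]|.

Definition bidegree (s : enhanced) : int * int :=
  (#|Bset s|%:Z - n_minus%:Z,
   label_degree s + #|Bset s|%:Z + n_plus%:Z - n_minus%:Z *+ 2).

Definition homogeneous (h q : int) : {pred chain} :=
  fun f => [forall s, (f s != 0) ==> (bidegree s == (h, q))].

Definition is_cycle (h q : int) : {pred chain} :=
  fun f => (f \in homogeneous h q) && (differential f == 0).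

Lemma differentialB : {morph differential : f g / f - g}.
Proof.
move=> f g; apply/ffunP => t; rewrite !ffunE -sumrB.
by apply: eq_bigr => s _; rewrite !ffunE mulrBr.
Qed.

Lemma differential0 : differential 0 = 0.
Proof. by have := differentialB 0 0; rewrite !subrr. Qed.

Lemma homogeneous_closed h q : zmod_closed (homogeneous h q).
Proof.
split=> [|f g /forallP hf /forallP hg]; apply/forallP => s.
  by rewrite ffunE eqxx.
apply/implyP; rewrite !ffunE => fg0.
case: (eqVneq (f s) 0) => [f0|f0]; last by move/implyP: (hf s); apply.
move/implyP: (hg s); apply; apply: contraNneq fg0 => g0.
by rewrite f0 g0 subrr.
Qed.

Lemma is_cycle_closed h q : zmod_closed (is_cycle h q).
Proof.
have [h0 hB] := homogeneous_closed h q.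
split=> [|f g /andP[hf /eqP df] /andP[hg /eqP dg]]; apply/andP; split.
- exact: h0.
- by rewrite differential0.
- exact: hB.
- by rewrite differentialB df dg subrr.
Qed.

HB.instance Definition _ h q :=
  GRing.isZmodClosed.Build chain (is_cycle h q) (is_cycle_closed h q).

Definition cycle_group h q := {f : chain | is_cycle h q f}.
HB.instance Definition _ h q := SubType.on (cycle_group h q).
HB.instance Definition _ h q := [Choice of cycle_group h q by <:].
HB.instance Definition _ h q :=
  [SubChoice_isSubZmodule of cycle_group h q by <:].

Definition is_boundary h q : {pred cycle_group h q} :=
  fun z => `[< exists2 g, g \in homogeneous (h - 1) q & val z = differential g >].

Lemma is_boundary_closed h q : zmod_closed (@is_boundary h q).
Proof.
have [h0 hB] := homogeneous_closed (h - 1) q.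
split=> [|z w /asboolP[f hf ef] /asboolP[g hg eg]]; apply/asboolP.
  by exists 0; rewrite ?differential0 ?raddf0.
by exists (f - g); rewrite ?hB // differentialB raddfB /= ef eg.
Qed.

HB.instance Definition _ h q :=
  GRing.isZmodClosed.Build (cycle_group h q) (@is_boundary h q)
    (@is_boundary_closed h q).

(* For a planar diagram the differential squares to zero, and Kh h q is the
   kernel of the differential in bidegree (h, q) modulo its image. *)
Definition Kh (h q : int) : zmodType :=
  Quotient.quot (@is_boundary h q).

End Khovanov.

Definition is_Z2_subgroup (V : zmodType) (S : set V) : Prop :=
  exists f : {additive 'Z_2 -> V}, injective f /\ S = range f.

Section Pretzel.
Variables (n : nat) (a : 'I_n -> int).

(* The crossing (l, k) is the k-th one from the top in the l-th column. The
   number of crossings of this column is |a l| as soon as a l is not zero. *)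
Definition pretzel_crossing : finType := {l : 'I_n & 'I_(`|a l|.-1.+1)}.

Definition pcrossing (l : 'I_n) (k : 'I_(`|a l|.-1.+1)) : pretzel_crossing :=
  Tagged (fun l => 'I_(`|a l|.-1.+1)) k.

(* The column next to the column l, on the east if x and on the west if not,
   in the cyclic order. *)
Definition next_column (x : bool) (l : 'I_n) : 'I_n :=
  if x then ordS l else ord_pred l.

Definition pretzel_glue (d : pretzel_crossing * corner) :
    pretzel_crossing * corner :=
  let: (existT l k, (x, y)) := d in
  if y then
    if k == ord0 then (pcrossing (l := next_column x l) ord0, (~~ x, y))
    else (pcrossing (l := l) (inord k.-1), (x, ~~ y))
  else
    if k == ord_max then (pcrossing (l := next_column x l) ord_max, (~~ x, y))
    else (pcrossing (l := l) (inord k.+1), (x, ~~ y)).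

Lemma next_columnK x l : next_column (~~ x) (next_column x l) = l.
Proof. by case: x; rewrite /= ?ordSK ?ord_predK. Qed.

Lemma pretzel_glueK : involutive pretzel_glue.
Proof.
case=> [[l k] [x []]] /=.
  case: (eqVneq k ord0) => [->|k_neq] /=; first by rewrite next_columnK negbK.
  have k_gt0 : (0 < k)%N by rewrite lt0n.
  have lt_k : (k.-1 < `|a l|.-1.+1)%N by rewrite (leq_ltn_trans (leq_pred _)).
  rewrite ifN; first by rewrite inordK // prednK // inord_val.
  by rewrite -val_eqE /= inordK // ltn_eqF // prednK // -ltnS.
case: (eqVneq k ord_max) => [->|k_neq] /=.
  by rewrite eqxx next_columnK negbK.
have lt_k : (k.+1 < `|a l|.-1.+1)%N.
  by rewrite ltnS ltn_neqAle k_neq -ltnS ltn_ord.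
by rewrite -val_eqE /= inordK //= inord_val.
Qed.

Lemma pretzel_glue_neq d : pretzel_glue d != d.
Proof.
case: d => [[l k] [x y]] /=.
by case: y; case: ifP => _; case: x; rewrite !xpair_eqE /= ?andbF.
Qed.

Definition pretzel : diagram :=
  @Diagram pretzel_crossing (fun c => 0 < a (tag c)) pretzel_glue
    pretzel_glueK pretzel_glue_neq.

End Pretzel.

(* Main.v *)
From HB Require Import structures.
Require Import Defs.
From mathcomp Require Import all_boot all_order all_algebra.
From mathcomp Require Import boolp classical_sets fintype finset.
From mathcomp Require Import zify ring.

(* A state S is good if all the crossings of the negative columns and at least two
   crossings of each positive column are B-smoothed. Thanks to the two negative
   columns, every edge of the cube that ends at a good state splits a circle.
   Given r, let e_r be the sum of the states with r_l B-smoothings in each column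
   l, all the circles being labelled 1. When e_r is differentiated, the terms
   coming from the column l telescope along the column: only its top and bottom
   circles survive, with coefficient x_top + (-1)^(r_l) x_bottom. These two circles
   coincide in a good state, so the result is 2x if r_l is even and 0 if r_l is
   odd (there is no term at all if the column is full). Hence, if every r_l is odd
   or maximal and if r_(l0) is odd, then lowering r_(l0) by one gives a chain whose
   differential is twice a cycle z_r, up to sign; z_r is the variant of e_r with
   the circle of the column l0 labelled x. Modulo 2, the sum of the coefficients
   of the enhanced states on a good state S with exactly one label x is a cocycle;
   for S with r_l B-smoothings in each column l, it takes the value 1 on z_r and
   vanishes on the other cycles z_r'. The possible values of r_l are 3, 5, ... and
   a_l, hence a_l / 2 choices for each positive column; only the choice r = a may
   lack an odd entry. *)
Set Implicit Arguments.
Unset Strict Implicit.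
Unset Printing Implicit Defensive.

Import Order.TTheory GRing.Theory Num.Theory.
Local Open Scope ring_scope.

(** * Circles and surgeries of a diagram *)

Lemma even_card_involutive (T : finType) (f : T -> T) (A : {set T}) :
  involutive f -> (forall x, f x != x) -> (forall x, (f x \in A) = (x \in A)) ->
  ~~ odd #|A|.
Proof.
move=> fK f_neq; have [m] := ubnP #|A|; elim: m A => // m IHm A leAm fA.
have [->|/set0Pn[x Ax]] := eqVneq A set0; first by rewrite cards0.
have Afx : f x \in A :\ x by rewrite !inE f_neq fA.
rewrite (cardsD1 x) Ax (cardsD1 (f x)) Afx /= negbK; apply: IHm => [|y].
  by move: leAm; rewrite (cardsD1 x) Ax (cardsD1 (f x)) Afx; lia.
rewrite !inE fA (inj_eq (can_inj fK)).
by rewrite (can2_eq fK fK) andbCA.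
Qed.

Section Circles.
Variable D : diagram.
Implicit Types (S : {set crossing D}) (C : {set dart D}) (d e : dart D).
Implicit Types (i : crossing D).

Lemma smoothK S : involutive (smooth S).
Proof.
by case=> i [x y] /=; case: ifP => v /=; rewrite v ?negbK.
Qed.

Lemma smooth_neq S d : smooth S d != d.
Proof.
case: d => i [x y] /=; case: ifP => _.
  by rewrite !xpair_eqE; case: y; rewrite ?andbF.
by rewrite !xpair_eqE; case: x; rewrite ?andbF.
Qed.

Lemma smooth_fst S d : (smooth S d).1 = d.1.
Proof. by case: d => i [x y] /=; case: ifP. Qed.

Lemma smooth_setD1 S i d : d.1 != i -> smooth (S :\ i) d = smooth S d.
Proof. by case: d => j [x y] /= ne; rewrite /vertical !inE ne. Qed.

Lemma connect_adjacent_sym S : connect_sym (adjacent S).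
Proof.
apply: sym_connect_sym => d e; rewrite /adjacent.
by rewrite [e == glue d]eq_sym (can2_eq (@glueK D) (@glueK D))
   [e == smooth S d]eq_sym (can2_eq (smoothK S) (smoothK S)).
Qed.

Lemma mem_circle S d e : (e \in circle S d) = connect (adjacent S) d e.
Proof. by rewrite inE. Qed.

Lemma circle_id S d : d \in circle S d.
Proof. by rewrite inE connect0. Qed.

Lemma eq_circle S d e : (circle S d == circle S e) = (e \in circle S d).
Proof.
apply/eqP/idP => [->|]; first exact: circle_id.
rewrite mem_circle => de; apply/setP => u; rewrite !mem_circle.
exact: same_connect (connect_adjacent_sym S) _ _ de u.
Qed.

Lemma circle_glue S d : circle S (glue d) = circle S d.
Proof.
by apply/esym/eqP; rewrite eq_circle mem_circle connect1 // /adjacent eqxx.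
Qed.

Lemma circle_smooth S d : circle S (smooth S d) = circle S d.
Proof.
by apply/esym/eqP; rewrite eq_circle mem_circle connect1 // /adjacent eqxx orbT.
Qed.

Lemma circle_min S (X : {set dart D}) d :
  (forall e, e \in X -> glue e \in X) ->
  (forall e, e \in X -> smooth S e \in X) ->
  d \in X -> circle S d \subset X.
Proof.
move=> gX sX dX; apply/subsetP => e; rewrite mem_circle => /connectP[p].
elim: p d dX => [|u p IHp] d dX /=; first by move=> _ ->.
by case/andP=> /orP[] /eqP-> /IHp; apply; [apply: gX | apply: sX].
Qed.

(** No circle leaves a set of darts stable under both involutions. This is how an edge is shown to
    split a circle. *)
Lemma circle_neq S (X : {set dart D}) d e :
  (forall u, u \in X -> glue u \in X) ->
  (forall u, u \in X -> smooth S u \in X) ->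
  d \in X -> e \notin X -> circle S d != circle S e.
Proof.
move=> gX sX dX; apply: contraNneq => de.
by apply: (subsetP (circle_min gX sX dX)); rewrite -eq_circle de.
Qed.

Lemma mem_circles S d : circle S d \in circles S.
Proof. exact: imset_f. Qed.

Lemma circlesP S C d : C \in circles S -> (d \in C) = (C == circle S d).
Proof. by case/imsetP=> e _ ->; rewrite eq_circle. Qed.

Lemma touchesE S C i : C \in circles S ->
  touches i C = (C == circle S (i, NW)) || (C == circle S (i, SE)).
Proof.
move=> SC; apply/existsP/orP => [[c]|].
  rewrite (circlesP _ SC) => /eqP ->; have := circle_smooth S (i, c).
  by case: c => [] [] [] /=; case: (vertical S i) => <-; rewrite eqxx; auto.
by case=> /eqP->; [exists NW | exists SE]; rewrite circle_id.
Qed.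

(** * Changing one smoothing: circles that merge or split *)

Section Split.
Variables (S : {set crossing D}) (i : crossing D).

(** The two smoothings agree away from [i], so a circle of either state that avoids [i] is closed
    under both. *)
Lemma not_touch_circles C : ~~ touches i C ->
  (C \in circles S) = (C \in circles (S :\ i)).
Proof.
have aux S1 S2 : (forall d, d.1 != i -> smooth S1 d = smooth S2 d) ->
    ~~ touches i C -> C \in circles S1 -> C \in circles S2.
  move=> eqS iC /imsetP[d _ defC]; apply/imsetP; exists d => //.
  have sub S3 S4 : (forall e, e.1 != i -> smooth S3 e = smooth S4 e) ->
      ~~ touches i (circle S3 d) -> circle S4 d \subset circle S3 d.
    move=> eqS34 i3; apply: circle_min => [e|e|].
    - by rewrite -[in X in _ -> X]eq_circle circle_glue eq_circle.
    - have [ei|ei] := eqVneq e.1 i; last first.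
        by rewrite -eqS34 // -[in X in _ -> X]eq_circle circle_smooth eq_circle.
      have not3 u : u.1 = i -> u \in circle S3 d = false.
        move=> ui; apply: contraNF i3 => du; apply/existsP; exists u.2.
        by rewrite -ui -surjective_pairing.
      by rewrite !not3 // smooth_fst.
    - exact: circle_id.
  have sub12 : circle S2 d \subset C by rewrite defC; apply: sub; rewrite -?defC.
  apply/eqP; rewrite eqEsubset sub12 andbT defC; apply: sub => [e /eqS->//|].
  apply: contra iC => /existsP[c dc]; apply/existsP; exists c.
  exact: (subsetP sub12).
by move=> iC; apply/idP/idP; apply: aux => // d di; rewrite smooth_setD1.
Qed.

Hypothesis Si : i \in S.
Hypothesis split : circle S (i, NW) != circle S (i, SE).

(* Otherwise exactly one corner of i would lie on both the circle of S and the
   circle of S :\ i through NW; but the darts common to both circles are even in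
   number, being paired by glue, and those away from i are paired by smooth. *)
Lemma split_merge : circle (S :\ i) (i, NW) = circle (S :\ i) (i, SE).
Proof.
apply/eqP; apply: contraT => neq'.
pose X := circle S (i, NW) :&: circle (S :\ i) (i, NW).
have gX d : (glue d \in X) = (d \in X).
  by rewrite !in_setI -!eq_circle !circle_glue.
have sX d : d.1 != i -> (smooth S d \in X) = (d \in X).
  move=> di; rewrite !in_setI -!eq_circle circle_smooth.
  by rewrite -(smooth_setD1 S di) circle_smooth.
pose Z := [set d : dart D | d.1 == i].
have inZ d : (d \in Z) = (d.1 == i) by rewrite inE.
pose Y := X :\: Z.
have sY d : (smooth S d \in Y) = (d \in Y).
  rewrite !in_setD !inZ smooth_fst.
  by have [//|di] := eqVneq d.1 i; rewrite sX.
have evenX := even_card_involutive (@glueK D) (@glue_neq D) gX.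
have evenY := even_card_involutive (smoothK S) (@smooth_neq S) sY.
suff Xi : X :&: Z = [set (i, NW)].
  by move: evenX; rewrite -(cardsID Z X) Xi cards1 add1n /= evenY.
apply/setP => -[j c]; rewrite in_setI inZ in_setI in_set1 /=.
have [->|ji] := eqVneq j i; last first.
  by rewrite andbF xpair_eqE (negPf ji).
rewrite andbT xpair_eqE eqxx /= -!eq_circle.
have vi : vertical S i = ~~ over_slash i by rewrite /vertical Si; case: over_slash.
have vi' : vertical (S :\ i) i = over_slash i.
  by rewrite /vertical !inE eqxx; case: over_slash.
have := circle_smooth S (i, c); have := circle_smooth (S :\ i) (i, c).
rewrite /smooth vi vi'.
move: split neq'; rewrite /NW /SE => /negPf split' /negPf neq'.
case: c => [] [] []; case: (over_slash i) => /= e1 e2; rewrite ?eqxx //.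
all: by rewrite ?(e1, e2) ?split' ?neq' ?andbF // -?e1 -?e2 ?split' ?neq' ?andbF.
Qed.

Lemma card_circles_split : #|circles S| = #|circles (S :\ i)|.+1.
Proof.
pose N := [set C in circles S | ~~ touches i C].
have -> : circles S = circle S (i, NW) |: (circle S (i, SE) |: N).
  apply/setP => C; rewrite !inE orbA.
  have [SC|SC] /= := boolP (C \in circles S).
    by rewrite (touchesE _ SC) orbN.
  rewrite orbF; apply/esym/norP.
  by split; apply: contraNneq SC => ->; apply: mem_circles.
have -> : circles (S :\ i) = circle (S :\ i) (i, NW) |: N.
  apply/setP => C; rewrite !inE; have [iC|iC] /= := boolP (touches i C).
    rewrite andbF orbF; apply/idP/eqP => [SC|->]; last exact: mem_circles.
    by move: iC; rewrite (touchesE _ SC) -split_merge orbb => /eqP.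
  rewrite andbT not_touch_circles //.
  have [->|] //= := eqVneq C (circle (S :\ i) (i, NW)).
  by rewrite mem_circles.
have touch S' c : touches i (circle S' (i, c)).
  by apply/existsP; exists c; apply: circle_id.
by rewrite !cardsU1 !inE !touch (negPf split) !andbF.
Qed.
End Split.

(** * Enhanced states with prescribed labels x, and their surgeries *)

Lemma surgery_Bset i s t : surgery i s t ->
  i \in Bset t /\ Bset s = Bset t :\ i.
Proof. by case/and4P=> iS /eqP-> _ _; rewrite setU11 setU1K. Qed.

Fact state_subproof S (M : {set {set dart D}}) :
  (S, circles S :\: M).2 \subset circles (S, circles S :\: M).1.
Proof. exact: subsetDl. Qed.

(** Here [M] holds the circles labelled x, contrary to the convention of [enhanced]; members of [M]
    that are not circles of [S] are ignored. *)
Definition state S M : enhanced D := Sub _ (state_subproof S M).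

Lemma Bset_state S M : Bset (state S M) = S. Proof. by []. Qed.

Lemma plus_state S M : plus (state S M) = circles S :\: M. Proof. by []. Qed.

Lemma eq_state t (M : {set {set dart D}}) :
  (forall C, C \in circles (Bset t) -> (C \in plus t) = (C \notin M)) ->
  t = state (Bset t) M.
Proof.
case: t => [[S P] /= subP]; rewrite /Bset /plus /= => PM.
apply: val_inj => /=; congr (_, _); apply/setP => C; rewrite !inE.
have [/PM ->|SC] := boolP (C \in circles S); first by rewrite andbT.
by rewrite andbF; apply: contraNF SC; apply: (subsetP subP).
Qed.

Lemma eq_state1 S C C' : C \in circles S ->
  (state S [set C] == state S [set C']) = (C == C').
Proof.
move=> SC; apply/eqP/eqP => [/(congr1 (@plus D))/setP/(_ C)|-> //].
by rewrite !plus_state !inE SC eqxx !andbT => /esym/negbFE/eqP.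
Qed.

(* The set of the circles labelled x, at most one; it is designated by a dart in
   order to make sense in all the states at once. *)
Definition marked S (K : option (dart D)) : {set {set dart D}} :=
  if K is Some d then [set circle S d] else set0.

Lemma marked_circles S K C : C \in marked S K -> C \in circles S.
Proof. by case: K => [d|]; rewrite inE // => /eqP->; apply: mem_circles. Qed.

Section SplitSurgery.
Variables (S : {set crossing D}) (i : crossing D).
Hypothesis Si : i \in S.
Hypothesis split : circle S (i, NW) != circle S (i, SE).
Variable K : option (dart D).

Lemma surgery_split s t : Bset s = S :\ i -> Bset t = S ->
  surgery i s t =
    ([set C in plus s | ~~ touches i C] == [set C in plus t | ~~ touches i C])
    && comul_term (circle (S :\ i) (i, NW) \in plus s)
         (circle S (i, NW) \in plus t) (circle S (i, SE) \in plus t).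
Proof.
move=> defs deft; rewrite /surgery defs deft setD1K // setD11 eqxx /=.
by rewrite (split_merge Si split) eqxx split.
Qed.

Lemma not_touch_marked C : ~~ touches i C ->
  (C \in marked (S :\ i) K) = (C \in marked S K).
Proof.
case: K => [d|] iC; last by rewrite !inE.
have := not_touch_circles S iC; rewrite !inE.
have [SC|SC /esym/negbT SC'] := boolP (C \in circles S).
  by move=> /esym SC'; rewrite -!circlesP.
have neq S' : C \notin circles S' -> (C == circle S' d) = false.
  by apply: contraNF => /eqP->; apply: mem_circles.
by rewrite !neq.
Qed.

(** Both sides say that the circle through the marked dart touches [i]: a circle avoiding [i] is the
    same in the two states. *)
Lemma marked_split : (circle (S :\ i) (i, NW) \in marked (S :\ i) K) =
  (circle S (i, NW) \in marked S K) || (circle S (i, SE) \in marked S K).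
Proof.
case: K not_touch_marked => [d|] nt; last by rewrite !inE.
rewrite !inE.
have -> : (circle (S :\ i) (i, NW) == circle (S :\ i) d) =
          touches i (circle (S :\ i) d).
  by rewrite (touchesE i (mem_circles _ d)) -(split_merge Si split) orbb eq_sym.
have -> : (circle S (i, NW) == circle S d) || (circle S (i, SE) == circle S d) =
          touches i (circle S d).
  by rewrite (touchesE i (mem_circles S d)) ![circle S d == _]eq_sym.
apply/idP/idP; apply: contraLR => iC.
  by have := nt _ iC; rewrite !inE eqxx => /eqP<-.
by have := nt _ iC; rewrite !inE eqxx => /esym/eqP<-.
Qed.

Lemma marked_split_neq :
  ~~ ((circle S (i, NW) \in marked S K) && (circle S (i, SE) \in marked S K)).
Proof.
case: K => [d|]; rewrite !inE //; apply: contraNN split => /andP[/eqP-> /eqP->].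
exact: eqxx.
Qed.

(** The coproduct sends 1 to the two ways of placing one x, and x to x on both circles. Either way
    one label x is added, on an unmarked circle that touches [i]. *)
Lemma surgery_marked C : C \in circles S -> C \notin marked S K ->
  surgery i (state (S :\ i) (marked (S :\ i) K)) (state S (C |: marked S K)) =
  touches i C.
Proof.
move=> SC KC; rewrite surgery_split // !plus_state.
have [iC|iC] := boolP (touches i C); last first.
  apply/negbTE/nandP; left; apply/eqP => /setP/(_ C); rewrite !inE iC eqxx /=.
  by rewrite not_touch_marked // KC -not_touch_circles // SC.
apply/andP; split.
  apply/eqP/setP => C'; rewrite !inE.
  have [//|iC'] := boolP (touches i C'); first by rewrite !andbF.
  rewrite not_touch_marked // -not_touch_circles //.
  by have [eqC|] := eqVneq C' C; first by rewrite eqC iC in iC'.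
move: KC; rewrite !inE !mem_circles !andbT marked_split.
move: iC; rewrite (touchesE _ SC) => /orP[] /eqP-> /negPf->;
rewrite eqxx ?[_ == circle S (i, NW)]eq_sym (negPf split) /= ?orbF.
all: by case: (_ \in _).
Qed.

Lemma surgery_marked_inv t : Bset t = S ->
  surgery i (state (S :\ i) (marked (S :\ i) K)) t ->
  exists C, [/\ C \in circles S, C \notin marked S K &
                t = state S (C |: marked S K)].
Proof.
move=> deft; rewrite surgery_split // => /andP[/eqP/setP nt].
rewrite !plus_state !inE mem_circles andbT marked_split => comul.
(* Of the two circles through [i], [C] is the unmarked one; if neither is marked, it is the one
   labelled x in [t]. *)
have [C [iC KC eNW eSE]] : exists C, [/\ C \in circles S /\ touches i C,
    C \notin marked S K,
    (circle S (i, NW) \in plus t) = (circle S (i, NW) \notin C |: marked S K) &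
    (circle S (i, SE) \in plus t) = (circle S (i, SE) \notin C |: marked S K)].
  have touch c : circle S (i, c) \in circles S /\ touches i (circle S (i, c)).
    by split; [apply: mem_circles | apply/existsP; exists c; apply: circle_id].
  have := marked_split_neq; move: comul; rewrite /comul_term.
  case KNW : (_ \in marked S K) => /=.
    move=> /andP[/negPf-> /negPf->] KSE; exists (circle S (i, SE)).
    by rewrite !inE eqxx KNW orbT.
  case KSE : (_ \in marked S K) => /=.
    move=> /andP[/negPf-> /negPf->] _; exists (circle S (i, NW)).
    by rewrite !inE eqxx KNW KSE orbT.
  case: (_ \in plus t) => /=; case: (_ \in plus t) => //= _ _.
    exists (circle S (i, SE)).
    by rewrite !inE eqxx KNW KSE (negPf split).
  exists (circle S (i, NW)).
  by rewrite !inE eqxx KNW KSE eq_sym (negPf split).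
exists C; split=> //; first by case: iC.
rewrite -[in state S _]deft; apply: eq_state => C'; rewrite deft => SC'.
have [|iC'] := boolP (touches i C').
  by rewrite (touchesE _ SC') => /orP[] /eqP->.
have := nt C'; rewrite !inE iC' !andbT not_touch_marked // => <-.
rewrite -not_touch_circles // SC' andbT.
have [eqC|//] := eqVneq C' C.
by case: iC => _; rewrite -eqC (negPf iC').
Qed.

(** If the merged circle were labelled x, both circles through [i] would be, whereas only [C] is. *)
Lemma surgery_one_x s C : C \in circles S -> Bset s = S :\ i ->
  surgery i s (state S [set C]) -> s = state (S :\ i) set0.
Proof.
move=> SC defs; rewrite surgery_split // => /andP[/eqP/setP nt].
rewrite !plus_state !inE !mem_circles !andbT => comul.
have [iC cs] : touches i C /\ circle (S :\ i) (i, NW) \in plus s.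
  rewrite (touchesE _ SC) ![C == _]eq_sym; move: comul; rewrite /comul_term.
  case: (_ \in plus s); last first.
    by rewrite !negbK => /andP[/eqP<-]; rewrite eq_sym (negPf split).
  by case: (_ == C); case: (_ == C).
rewrite -defs; apply: eq_state => C'; rewrite inE /= defs => SC'.
have [iC'|iC'] := boolP (touches i C').
  by move: iC'; rewrite (touchesE _ SC') -(split_merge Si split) orbb => /eqP->.
have := nt C'; rewrite !inE iC' !andbT => ->.
rewrite (not_touch_circles S iC') SC' andbT.
by apply: contraNneq iC' => ->.
Qed.
End SplitSurgery.

(** * States all of whose incoming edges split a circle *)

Definition splitting S :=
  [forall i in S, circle S (i, NW) != circle S (i, SE)].

Lemma splittingP S i : splitting S -> i \in S ->
  circle S (i, NW) != circle S (i, SE).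
Proof. by move=> /forall_inP; apply. Qed.

(** Each crossing added on the way from [S0] to [S] creates one circle. *)
Lemma card_circles_splitting S0 S : S0 \subset S ->
  (forall S1 : {set crossing D},
    S0 \subset S1 -> S1 \subset S -> splitting S1) ->
  (#|circles S| + #|S0| = #|circles S0| + #|S|)%N.
Proof.
have [m] := ubnP #|S :\: S0|; elim: m S => // m IHm S ltm S0S spl.
have [S0_S|/set0Pn[i]] := eqVneq (S :\: S0) set0.
  have -> // : S = S0.
  by apply/eqP; rewrite eqEsubset S0S -setD_eq0 S0_S eqxx.
rewrite inE => /andP[S0i Si].
have S0S' : S0 \subset S :\ i.
  by rewrite subsetD1 S0S.
have splS := spl S S0S (subxx S).
have := IHm (S :\ i); rewrite (card_circles_split Si (splittingP splS Si)).
rewrite (cardsD1 i S) Si addSn => -> //; first by rewrite add1n addnS.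
  have lt : #|(S :\ i) :\: S0| = #|(S :\: S0) :\ i|.
    by congr #|pred_of_set _|; apply/setP => j; rewrite !inE andbCA.
  by move: ltm; rewrite (cardsD1 i) inE S0i Si lt add1n.
by move=> S1 S01 S1S; apply: spl => //; apply: subset_trans S1S (subsetDl _ _).
Qed.

(** The option [K] is coerced to a boolean, so that [K%:Z] is the number of labels x. *)
Lemma label_degree_marked S K :
  label_degree (state S (marked S K)) = #|circles S|%:Z - K%:Z *+ 2.
Proof.
have sub : marked S K \subset circles S.
  by apply/subsetP => C; apply: marked_circles.
rewrite /label_degree plus_state Bset_state setDDr setDv set0U (setIidPr sub).
have := cardsD (circles S) (marked S K); rewrite (setIidPr sub).
have := subset_leq_card sub.
have -> : #|marked S K| = K by case: K {sub} => [d|]; rewrite ?cards1 ?cards0.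
by move: #|_ :\: _| => u; lia.
Qed.

(** When [W] consists of the states with given column sizes, [K = None] gives the chains e_r and
    [K = Some d] the chains z_r. *)
Definition marked_sum (W : {set {set crossing D}}) K : chain D :=
  [ffun s => ((Bset s \in W) && (s == state (Bset s) (marked (Bset s) K)))%:R].

Lemma marked_sum_homogeneous (o : orientation D) (W : {set {set crossing D}})
    K h q :
  (forall S, S \in W -> bidegree o (state S (marked S K)) = (h, q)) ->
  marked_sum W K \in homogeneous o h q.
Proof.
move=> WH; apply/forallP => s; apply/implyP; rewrite ffunE.
case: andP => [[Ws /eqP->]|] //= _; rewrite WH //.
Qed.

(** Given [t] and [i], the source state must be [Bset t :\ i], and the chain contains only one
    enhanced state on it. *)
Lemma differential_marked_sum W K t : differential (marked_sum W K) t =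
  \sum_(i in Bset t | Bset t :\ i \in W)
    edge_sign (Bset t :\ i) i *
    (surgery i (state (Bset t :\ i) (marked (Bset t :\ i) K)) t)%:R.
Proof.
rewrite ffunE.
transitivity (\sum_i \sum_s (surgery i s t)%:R * edge_sign (Bset s) i *
                            marked_sum W K s).
  rewrite exchange_big; apply: eq_bigr => s _ /=.
  rewrite -big_distrl /=; congr (_ * _).
  by rewrite /incidence big_mkcond; apply: eq_bigr => i _; case: surgery;
    rewrite ?mul1r ?mul0r.
rewrite [RHS]big_mkcond; apply: eq_bigr => i _ /=.
case: ifP => [/andP[Si Wi]|nSi].
  rewrite (bigD1 (state (Bset t :\ i) (marked (Bset t :\ i) K))) //=.
  rewrite ffunE Bset_state Wi eqxx mulr1 mulrC big1 ?addr0 // => s ne.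
  rewrite ffunE; have [sur|] := boolP (surgery i s t); last by rewrite !mul0r.
  by have [_ ->] := surgery_Bset sur; rewrite (negPf ne) andbF mulr0.
rewrite big1 // => s _.
have [sur|] := boolP (surgery i s t); last by rewrite !mul0r.
have [it defs] := surgery_Bset sur; move: nSi; rewrite it /= -defs ffunE => ->.
by rewrite mulr0.
Qed.

Lemma marked_sum1 W S C d : C \in circles S ->
  marked_sum W (Some d) (state S [set C]) =
  ((S \in W) && (C == circle S d))%:R.
Proof. by move=> SC; rewrite ffunE Bset_state eq_state1. Qed.

Lemma differential_marked_sumE W K S C : splitting S ->
  C \in circles S -> C \notin marked S K ->
  differential (marked_sum W K) (state S (C |: marked S K)) =
  \sum_(i in S | S :\ i \in W) edge_sign (S :\ i) i * (touches i C)%:R.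
Proof.
move=> spl SC KC; rewrite differential_marked_sum Bset_state.
apply: eq_bigr => i /andP[Si _]; rewrite surgery_marked //.
exact: splittingP.
Qed.

Lemma differential_marked_sum_neq0 W K t : splitting (Bset t) ->
  differential (marked_sum W K) t != 0 ->
  exists C, [/\ C \in circles (Bset t), C \notin marked (Bset t) K &
                t = state (Bset t) (C |: marked (Bset t) K)].
Proof.
rewrite differential_marked_sum => spl nz.
have [i /andP[ti sur]] : exists i, (i \in Bset t) &&
    surgery i (state (Bset t :\ i) (marked (Bset t :\ i) K)) t.
  apply/existsP; apply: contraNT nz => /existsPn none; rewrite big1 // => i.
  by case/andP=> ti _; move: (none i); rewrite ti /= => /negPf->; rewrite mulr0.
exact: (@surgery_marked_inv _ i ti (splittingP spl ti) K t erefl sur).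
Qed.

Lemma sum_touches S i : circle S (i, NW) != circle S (i, SE) ->
  \sum_(C in circles S) (touches i C)%:R = 2 :> int.
Proof.
move=> spl; rewrite (bigD1 (circle S (i, NW))) ?mem_circles //=.
rewrite (bigD1 (circle S (i, SE))) /=; last by rewrite mem_circles eq_sym.
rewrite !(touchesE i (mem_circles _ _)) !eqxx orbT big1 ?addr0 // => C.
by case/andP=> /andP[SC /negPf n1] /negPf n2; rewrite (touchesE i SC) n1 n2.
Qed.

(* The two terms of the coproduct of 1 are equal modulo 2 once the position of the
   label x is forgotten. *)
Lemma one_x_cocycle S (f : chain D) : splitting S ->
  exists m : int,
    \sum_(C in circles S) differential f (state S [set C]) = m *+ 2.
Proof.
move=> spl.
(* Each edge into [S] has one relevant source, labelled 1 everywhere, and it reaches two of the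
   summed states. *)
exists (\sum_(i in S) edge_sign (S :\ i) i * f (state (S :\ i) set0)).
rewrite -mulr_natr big_distrl /=.
transitivity (\sum_(C in circles S) \sum_(i in S)
   edge_sign (S :\ i) i * f (state (S :\ i) set0) * (touches i C)%:R).
  apply: eq_bigr => C SC; rewrite ffunE.
  under eq_bigr do rewrite big_distrl big_mkcond /=.
  rewrite exchange_big [RHS]big_mkcond; apply: eq_bigr => i _ /=.
  have sur s : surgery i s (state S [set C]) ->
      i \in S /\ s = state (S :\ i) set0.
    move=> sur; have [Si defs] := surgery_Bset sur; split=> //.
    exact: (surgery_one_x Si (splittingP spl Si) SC).
  case: ifP => Si; last first.
    by rewrite big1 // => s _; case: ifP => // /sur[]; rewrite Si.
  rewrite (bigD1 (state (S :\ i) set0)) //= big1 => [|s ne]; last first.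
    by case: ifP => // /sur[_ eqs]; rewrite eqs eqxx in ne.
  rewrite addr0; have := @surgery_marked S i Si (splittingP spl Si) None C SC.
  rewrite /= setU0 inE => -> //.
  by case: touches; rewrite ?mulr1 ?mulr0.
rewrite exchange_big; apply: eq_bigr => i Si /=.
by rewrite -big_distrr /= sum_touches // splittingP.
Qed.

End Circles.

(** * Subgroups of order two *)

Lemma Z2_subgroup (V : zmodType) (v : V) : v *+ 2 = 0 -> v != 0 ->
  is_Z2_subgroup (fun u : V => u = 0 \/ u = v).
Proof.
move=> v2 v0; pose f (k : 'Z_2) := v *+ k.
have v_mod m : v *+ (m %% 2)%N = v *+ m.
  by rewrite [in RHS](divn_eq m 2) mulrnDr mulnC mulrnA v2 mul0rn add0r.
have f_additive : zmod_morphism f.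
  move=> k k'; rewrite /f /= v_mod mulrnDr v_mod mulrnBr ?v2 ?sub0r //.
  exact/ltnW/(ltn_ord k').
pose F : {additive 'Z_2 -> V} := HB.pack f
  (GRing.isZmodMorphism.Build _ _ f f_additive).
exists F; split.
  have inj k k' : (k < 2)%N -> (k' < 2)%N -> v *+ k = v *+ k' -> k = k'.
    by case: k k' => [|[|//]] [|[|//]] // _ _ /eqP;
      rewrite mulr0n mulr1n ?(negPf v0) // eq_sym (negPf v0).
  by move=> k k' /inj e; apply/val_inj/e; apply: ltn_ord.
apply/seteqP; split=> [u [->|->]|_ [[[|[|k]] Hk] _ <-]] //=.
- by exists 0.
- by exists 1.
- by left.
- by right.
Qed.

Definition homology_class (D : diagram) (o : orientation D) h q
    (c : cycle_group o h q) : Kh o h q :=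
  (\pi_(Quotient.quot (@is_boundary D o h q)) c)%qT.

Lemma homology_class_eq (D : diagram) (o : orientation D) h q
    (c c' : cycle_group o h q) :
  homology_class c = homology_class c' <-> is_boundary (c - c').
Proof.
rewrite -[is_boundary _]/(c - c' \in @is_boundary D o h q) Quotient.idealrBE.
exact: (rwP eqP).
Qed.

Lemma homology_class_eq0 (D : diagram) (o : orientation D) h q
    (c : cycle_group o h q) :
  homology_class c = 0 <-> is_boundary c.
Proof.
rewrite -[in is_boundary _](subr0 c) -homology_class_eq.
by rewrite -[homology_class 0]/(\pi_(Quotient.quot _) 0)%qT raddf0.
Qed.

Section TorsionFamily.
Variables (D : diagram) (o : orientation D) (N : nat).
Variables (hq : 'I_N -> int * int) (w z : 'I_N -> chain D).
Variable S : 'I_N -> {set crossing D}.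
Hypothesis z_cycle : forall m, z m \in is_cycle o (hq m).1 (hq m).2.
Hypothesis w_homogeneous :
  forall m, w m \in homogeneous o ((hq m).1 - 1) (hq m).2.
Hypothesis dw : forall m, differential (w m) = z m *+ 2.
Hypothesis S_splitting : forall m, splitting (S m).
Hypothesis S_z : forall m m',
  \sum_(C in circles (S m)) z m' (state (S m) [set C]) = (m == m')%:R.

(** By [S_z] the functionals of [one_x_cocycle] at the states [S m] are dual modulo 2 to the cycles
    [z m]. Hence neither [z m] nor a difference of two of them is a boundary, while [dw] makes twice
    each class vanish. *)
Lemma torsion_family :
  exists T : 'I_N -> {hq : int * int & set (Kh o hq.1 hq.2)},
    injective T /\ forall m, is_Z2_subgroup (projT2 (T m)).
Proof.
have not_boundary m (f g : chain D) :
    \sum_(C in circles (S m)) f (state (S m) [set C]) = 1 ->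
    f <> differential g.
  move=> f1 fg; have [k] := one_x_cocycle g (S_splitting m).
  by rewrite -fg f1; lia.
pose zc m : cycle_group o (hq m).1 (hq m).2 := Sub (z m) (z_cycle m).
pose v m := homology_class (zc m).
have v2 m : v m *+ 2 = 0.
  rewrite mulr2n -raddfD; apply/homology_class_eq0/asboolP.
  by exists (w m); [apply: w_homogeneous | rewrite dw mulr2n].
have v0 m : v m != 0.
  apply/eqP => /homology_class_eq0/asboolP[g _].
  by apply: (not_boundary m); rewrite S_z eqxx.
pose T m : {hq : int * int & set (Kh o hq.1 hq.2)} :=
  existT (fun hq => set (Kh o hq.1 hq.2)) (hq m) (fun u => u = 0 \/ u = v m).
exists T; split; last first.
  by move=> m; exact: Z2_subgroup (v2 m) (v0 m).
(* The values of [T] may live in different bidegrees; [raw] turns them into sets of chains, which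
   can be compared. *)
pose raw (U : {hq : int * int & set (Kh o hq.1 hq.2)}) (f : chain D) :=
  exists2 c : cycle_group o (tag U).1 (tag U).2,
    val c = f & projT2 U (homology_class c).
move=> m m' /(congr1 raw)/(congr1 (fun A => A (z m))) eq_raw.
have : raw (T m) (z m).
  by exists (zc m); [by [] | right].
(* Thus [z m], read in the bidegree of [m'], is a boundary or homologous to [z m']. *)
rewrite eq_raw => -[c cz] [] /=.
  case/homology_class_eq0/asboolP => g _; rewrite [LHS]cz =>
    /(@not_boundary m)[].
  by rewrite S_z eqxx.
case/homology_class_eq/asboolP => g _; rewrite raddfB [X in X - _]cz /=.
have [//|mm'] := eqVneq m m'; move=>
    /(@not_boundary m)[].
under eq_bigr do rewrite !ffunE.
by rewrite big_split sumrN /= !S_z eqxx (negPf mm') subr0.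
Qed.
End TorsionFamily.

(** * Pretzel diagrams *)

Section LexicographicRank.
Variables (n : nat) (m : 'I_n -> nat).
Local Notation T := {l : 'I_n & 'I_(m l)}.

Definition lex_lt : rel T := fun i j =>
  (tag i < tag j)%N || (tag i == tag j :> nat) && (tagged i < tagged j)%N.

Lemma pairwise_enum_ord p :
  pairwise (fun k k' : 'I_p => k < k')%N (enum 'I_p).
Proof.
rewrite -(pairwise_map val ltn) val_enum_ord -sorted_pairwise.
  exact: iota_ltn_sorted.
exact: ltn_trans.
Qed.

(** A sigma type is enumerated fibre by fibre, so the ranks that govern [edge_sign] run column by
    column, from top to bottom. *)
Lemma enum_rank_lex (i j : T) : (enum_rank i < enum_rank j)%N = lex_lt i j.
Proof.
have lex_trans : transitive lex_lt by move=> y x z; rewrite /lex_lt; lia.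
have enum_lex : sorted lex_lt (enum {: T}).
  rewrite sorted_pairwise // enumT [Finite.enum]unlock /= /tag_enum -enumT.
  elim: (enum 'I_n) (pairwise_enum_ord n) => //= l s IHs /andP[/allP ls /IHs IH].
  rewrite pairwise_cat IH andbT -enumT pairwise_map; apply/andP; split.
    apply/allrelP => _ j' /mapP[k _ ->] /flattenP[_ /mapP[l' sl' ->]].
    case/mapP=> k' _ ->.
    by rewrite /lex_lt /= ls.
  apply: sub_pairwise (pairwise_enum_ord _) => k k'.
  by rewrite /lex_lt /= eqxx => ->; rewrite orbT.
have mono (x y : T) : (enum_rank x < enum_rank y)%N -> lex_lt x y.
  move=> xy; have := sorted_ltn_nth lex_trans x enum_lex.
  move=> /(_ (enum_rank x) (enum_rank y)); rewrite !inE -cardE !ltn_ord.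
  by move=> /(_ isT isT xy); rewrite !nth_enum_rank.
apply/idP/idP => [/mono //|ij]; rewrite ltnNge leq_eqVlt; apply/norP; split.
  apply/eqP => /val_inj/enum_rank_inj eqji; move: ij; rewrite eqji /lex_lt; lia.
by apply/negP => /mono; move: ij; rewrite /lex_lt; lia.
Qed.
End LexicographicRank.

(** * Circles in the states of a pretzel diagram *)

Section PretzelStates.
Variables (n : nat) (a : 'I_n -> int).
Local Notation D := (pretzel a).
Local Notation height l := (`|a l|.-1.+1).
Implicit Types (S : {set crossing D}) (l : 'I_n) (x y : bool).

Definition at_col l (k : 'I_(height l)) : crossing D := pcrossing k.

Definition level S l (m : nat) : nat :=
  \sum_(k < height l | (k < m)%N) (at_col k \in S).

Definition csize S l : nat := level S l (height l).

Lemma level0 S l : level S l 0 = 0%N.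
Proof. by rewrite /level big1. Qed.

Lemma levelS S l (k : 'I_(height l)) :
  level S l k.+1 = (level S l k + (at_col k \in S))%N.
Proof.
rewrite /level (bigD1 k) //= addnC; congr (_ + _)%N; apply: eq_bigl => j.
by rewrite ltnS [RHS]ltn_neqAle andbC.
Qed.

Lemma csizeE S l : csize S l = (\sum_(k < height l) (at_col k \in S))%N.
Proof. by apply: eq_bigl => k; rewrite ltn_ord. Qed.

Lemma leq_csize S l : (csize S l <= height l)%N.
Proof.
rewrite csizeE -[leqRHS]card_ord -sum1_card.
by apply: leq_sum => k _; apply: leq_b1.
Qed.

Lemma leq_level S l m : (level S l m <= csize S l)%N.
Proof.
rewrite csizeE (bigID (fun k : 'I_(height l) => k < m)%N) /= leq_addr //.
Qed.

Lemma vertical_col S l (k : 'I_(height l)) :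
  vertical S (at_col k) = ((0 < a l) != (at_col k \in S)).
Proof. by []. Qed.

(* The m-th point from the top of the side x of the column l: it lies just above
   the m-th crossing, except for the last one, below all the crossings. *)
Definition node x l (m : nat) : dart D :=
  if m is k.+1 then (at_col (inord k : 'I_(height l)), (x, false))
  else (at_col (ord0 : 'I_(height l)), (x, true)).

Lemma node_bot x l (k : 'I_(height l)) :
  node x l k.+1 = (at_col k, (x, false)).
Proof. by rewrite /node inord_val. Qed.

Lemma circle_top S x l (k : 'I_(height l)) :
  circle S (at_col k, (x, true)) = circle S (node x l k).
Proof.
case: k => [[|k] Hk]; rewrite /node.
  by congr (circle S (at_col _, _)); apply: val_inj.
by rewrite -circle_glue.
Qed.

Lemma circle_vertical S x l (k : 'I_(height l)) : vertical S (at_col k) ->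
  circle S (node x l k.+1) = circle S (node x l k).
Proof.
move=> v; rewrite node_bot -circle_top -circle_smooth.
by rewrite /smooth -/(vertical S (at_col k)) v.
Qed.

Lemma circle_horizontal S x y l (k : 'I_(height l)) :
  ~~ vertical S (at_col k) ->
  circle S (at_col k, (x, y)) = circle S (at_col k, (~~ x, y)).
Proof.
move=> v; rewrite -[LHS]circle_smooth /smooth.
by rewrite -/(vertical S (at_col k)) (negPf v).
Qed.

Lemma circle_chain S x l (m m' : nat) : (m <= m' <= height l)%N ->
  (forall k : 'I_(height l), (m <= k < m')%N -> vertical S (at_col k)) ->
  circle S (node x l m') = circle S (node x l m).
Proof.
elim: m' => [|m' IHm] /andP[]; first by rewrite leqn0 => /eqP->.
rewrite leq_eqVlt => /predU1P[-> //|lt_mm' lt_m'] v.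
rewrite (circle_vertical x (k := Ordinal lt_m')) /=; last by apply: v => /=; lia.
by apply: IHm => [|k km]; [lia | apply: v; lia].
Qed.

Lemma circle_top_next S x l :
  circle S (node x l 0) = circle S (node (~~ x) (next_column x l) 0).
Proof. by rewrite -[LHS]circle_glue. Qed.

Lemma inord_max p : inord p = ord_max :> 'I_p.+1.
Proof. by apply: val_inj; rewrite /= inordK. Qed.

Lemma circle_bot_next S x l : circle S (node x l (height l)) =
  circle S (node (~~ x) (next_column x l) (height (next_column x l))).
Proof. by rewrite -[LHS]circle_glue /node !inord_max /= eqxx. Qed.

(** The first non-vertical crossing from the top joins the two top ends of the column, and the last
    one joins the two bottom ends. *)
Lemma circle_across S x l (k : 'I_(height l)) : ~~ vertical S (at_col k) ->
  circle S (node x l 0) = circle S (node (~~ x) l 0) /\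
  circle S (node x l (height l)) = circle S (node (~~ x) l (height l)).
Proof.
move=> vk; split.
  case: (arg_minnP (P := fun k => ~~ vertical S (at_col k)) val vk) => j vj minj.
  have chain x' : circle S (node x' l j) = circle S (node x' l 0).
    apply: circle_chain => [|i ij]; first by rewrite leq0n ltnW.
    by apply: contraTT ij => /minj; rewrite -leqNgt.
  by rewrite -!chain -!circle_top (circle_horizontal _ _ vj).
case: (arg_maxnP (P := fun k => ~~ vertical S (at_col k)) val vk) => j vj maxj.
have chain x' : circle S (node x' l (height l)) = circle S (node x' l j.+1).
  apply: circle_chain => [|i /andP[ij _]]; first by rewrite leqnn andbT.
  by apply: contraTT ij => /maxj; rewrite -leqNgt.
by rewrite !chain !node_bot (circle_horizontal _ _ vj).
Qed.

Definition good S := (forall l, 0 < a l -> (1 < csize S l)%N) /\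
  (forall l (k : 'I_(height l)), ~~ (0 < a l) -> at_col k \in S).

Lemma iter_ordS l l' : exists m, iter m (@ordS n) l = l'.
Proof.
have val_iter m : iter m (@ordS n) l = ((l + m) %% n)%N :> nat.
  elim: m => [|m IHm]; first by rewrite addn0 modn_small.
  by rewrite /= IHm -addn1 modnDml addn1 addnS.
exists (l' + n - l)%N; apply: val_inj; rewrite /= val_iter.
have -> : (l + (l' + n - l) = l' + n)%N by have := ltn_ord l; lia.
by rewrite modnDr modn_small.
Qed.

Lemma exists_horizontal S l : (0 < a l) -> (0 < csize S l)%N ->
  exists k : 'I_(height l), ~~ vertical S (at_col k).
Proof.
move=> al; rewrite csizeE lt0n sum_nat_eq0 negb_forall => /existsP[k].
by rewrite eqb0 negbK => Sk; exists k; rewrite vertical_col al Sk.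
Qed.

(** Going east, positive columns are passed at the top and at the bottom alike by [circle_across],
    until a column that is not positive is met: its vertical arcs join top and bottom. *)
Lemma circle_top_bot S l : good S -> (exists j, a j < 0) ->
  circle S (node false l 0) = circle S (node false l (height l)).
Proof.
move=> [posS negS] [j aj]; have [m] := iter_ordS l j.
elim: m l => [l lj|m IHm l].
  have -> : l = j by [].
  symmetry; apply: circle_chain => [|k _]; rewrite ?leqnn // vertical_col.
  by rewrite negS ltNge (ltW aj).
rewrite iterSr => /IHm IH; have [al|al] := boolP (0 < a l); last first.
  symmetry; apply: circle_chain => [|k _]; rewrite ?leqnn //.
  by rewrite vertical_col (negPf al) negS.
have [k vk] := exists_horizontal al (ltnW (posS l al)).
have [-> ->] := circle_across false vk.
by rewrite circle_top_next circle_bot_next.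
Qed.

(** Another B-smoothed crossing of the column is next to [k]; the darts between the two form a union
    of circles containing exactly one of the corners NW and SE of [k]. *)
Lemma split_positive S l (k : 'I_(height l)) : 0 < a l -> (1 < csize S l)%N ->
  at_col k \in S ->
  circle S (at_col k, NW) != circle S (at_col k, SE).
Proof.
move=> al Sl Sk.
(* The darts of the column l between its t-th and (t+1)-st B-smoothed crossings. *)
pose X t : {set dart D} := [set d : dart D | (tag d.1 == l) &&
  (level S (tag d.1) (tagged d.1 + ~~ d.2.2) == t)].
(* The bounds on [t] keep the region away from both ends of the column, where [glue] would leave
   it. *)
have gX t : (0 < t < csize S l)%N -> forall u, u \in X t -> glue u \in X t.
  move=> /andP[t0 tl] [[l' k'] [x y]]; rewrite !inE /= => /andP[/eqP el].
  subst l'; case: y => /=.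
    rewrite addn0; have [->|k0] := eqVneq k' ord0.
      by rewrite /= level0 => /eqP e; rewrite -e in t0.
    have k0' : (0 < k')%N by rewrite lt0n.
    have lt_k' : (k'.-1 < height l)%N by rewrite (prednK k0') ltnW.
    by rewrite /= eqxx inordK // addn1 (prednK k0').
  rewrite addn1; have [->|km] := eqVneq k' ord_max.
    by move=> /eqP e; rewrite -e ltnn in tl.
  rewrite /= eqxx addn0 inordK // ltnS ltn_neqAle -ltnS ltn_ord andbT.
  by apply: contraNneq km => e; apply/eqP/val_inj.
have sX t : forall u, u \in X t -> smooth S u \in X t.
  move=> [[l' k'] [x y]]; rewrite !inE /= => /andP[/eqP el].
  subst l'; rewrite -/(at_col k') vertical_col al.
  have := levelS S k'; case: (at_col k' \in S) => /=; first by rewrite eqxx.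
  by case: y; rewrite /= !(addn0, addn1) eqxx => ->.
have in_X t x y : ((at_col k, (x, y)) \in X t) = (level S l (k + ~~ y) == t).
  by rewrite inE /= eqxx.
have lt_k : (level S l k < csize S l)%N.
  by apply: leq_trans (leq_level S l k.+1); rewrite levelS Sk addn1.
(* If [k] is the first B-smoothed crossing, the region below it is used, otherwise the region above
   it. *)
have [k0|k0] := posnP (level S l k).
  rewrite eq_sym; apply: (circle_neq (gX 1%N Sl) (sX 1%N)).
    by rewrite in_X /= addn1 levelS Sk k0.
  by rewrite in_X /= addn0 k0.
apply: (circle_neq (gX (level S l k) _) (sX _)); first by rewrite k0.
  by rewrite in_X /= addn0.
by rewrite in_X /= addn1 levelS Sk; lia.
Qed.

(** Two vertically smoothed columns cut the diagram into two parts, and the two sides of the column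
    [l] lie in different parts. *)
Lemma split_negative S l l' (k : 'I_(height l)) : l != l' ->
  (forall j : 'I_(height l), vertical S (at_col j)) ->
  (forall j : 'I_(height l'), vertical S (at_col j)) ->
  circle S (at_col k, NW) != circle S (at_col k, SE).
Proof.
move=> ll' vl vl'.
(* The cyclic distance from [l], counted eastwards. *)
pose dist (c : 'I_n) : nat := if (l <= c)%N then (c - l)%N else (c + n - l)%N.
have dist_lt c : (dist c < n)%N.
  by rewrite /dist; have := ltn_ord c; have := ltn_ord l; case: ifP; lia.
have dist_l : dist l = 0%N by rewrite /dist leqnn subnn.
have dist_inj c c' : dist c = dist c' -> c = c'.
  move=> e; apply: val_inj => /=; move: e; rewrite /dist.
  have := ltn_ord c; have := ltn_ord c'; have := ltn_ord l.
  by do 2!case: ifP; lia.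
have dist_S c : ((dist c).+1 < n)%N -> dist (ordS c) = (dist c).+1.
  have ltc := ltn_ord c; have ltl := ltn_ord l; rewrite /dist /=.
  have [cn|cn] := eqVneq c.+1 n; first by rewrite cn modnn; do 2!case: ifP; lia.
  by rewrite modn_small; [do 2!case: ifP; lia | lia].
have dist_pred c : (0 < dist c)%N -> dist (ord_pred c) = (dist c).-1.
  have ltc := ltn_ord c; have ltl := ltn_ord l; rewrite /dist /=.
  have [->|c0] := posnP c.
    by rewrite modn_small; [do 2!case: ifP; lia | lia].
  have -> : ((c + n).-1 = c.-1 + n)%N by lia.
  by rewrite modnDr modn_small; [do 2!case: ifP; lia | lia].
(* X is the region that lies east of the column l and west of the column l'. *)
pose pos (d : dart D) : nat := ((dist (tag d.1)).*2 + d.2.1)%N.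
pose X := [set d : dart D | (0 < pos d <= (dist l').*2)%N].
have dl' : (0 < dist l')%N.
  rewrite lt0n; apply: contraNneq ll' => e.
  by apply/eqP/dist_inj; rewrite dist_l e.
rewrite eq_sym; apply: (@circle_neq _ S X) => [[[c k'] [x y]]|[[c k'] [x y]]||].
- rewrite !inE /pos /=; have := dist_lt l'; have := dist_lt c.
  have step : (0 < (dist c).*2 + x <= (dist l').*2)%N ->
              (0 < (dist (next_column x c)).*2 + ~~ x <= (dist l').*2)%N.
    have := dist_lt l'; have := dist_S c; have := dist_pred c.
    by case: x => /=; lia.
  by case: y; case: ifP => _ _ _ /=.
- rewrite !inE /pos /= -/(at_col k').
  case: ifP => //= v.
  have ne c' : (forall j : 'I_(height c'), vertical S (at_col j)) ->
    dist c <> dist c'.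
    by move=> vc' /dist_inj cc'; subst c'; rewrite vc' in v.
  by have := ne _ vl; have := ne _ vl'; rewrite dist_l; case: x => /=; lia.
- by rewrite inE /pos /= dist_l; lia.
- by rewrite inE /pos /= dist_l.
Qed.

Definition two_negative := exists j k : 'I_n, [/\ j <> k, a j < 0 & a k < 0].

Lemma splitting_good S : two_negative -> good S -> splitting S.
Proof.
move=> [j [j' [/eqP jj' aj aj']]] [posS negS]; apply/forall_inP => -[l k] Sk.
have [al|al] := boolP (0 < a l); first exact: split_positive (posS l al) Sk.
have vert l' : ~~ (0 < a l') -> forall i : 'I_(height l'), vertical S (at_col i).
  by move=> al' i; rewrite vertical_col negS // (negPf al').
have neg_vert l' : a l' < 0 -> forall i : 'I_(height l'), vertical S (at_col i).
  by move=> al'; apply: vert; rewrite lt_gtF.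
have [lj|lj] := eqVneq l j.
  apply: (split_negative (l' := j') k _ (vert l al) (neg_vert _ aj')).
  by rewrite lj.
exact: (split_negative (l' := j) k lj (vert l al) (neg_vert _ aj)).
Qed.

(** The smoothing at [k] is horizontal, so its two circles pass through the points of the west side
    just above and just below it; they differ because [S] is splitting. *)
Lemma touches_good S l (k : 'I_(height l)) (C : {set dart D}) :
  two_negative -> good S -> 0 < a l -> at_col k \in S -> C \in circles S ->
  (touches (at_col k) C)%:R =
    (C == circle S (node false l k))%:R + (C == circle S (node false l k.+1))%:R
    :> int.
Proof.
move=> neg2 goodS al Sk SC; have := splittingP (splitting_good neg2 goodS) Sk.
rewrite (touchesE _ SC) circle_top.
rewrite (circle_horizontal _ _ (_ : ~~ vertical S (at_col k))).
  rewrite -node_bot; have [->|_] := eqVneq C (circle S (node false l k)).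
    by move=> /negPf->; rewrite addr0.
  by rewrite add0r.
by rewrite vertical_col al Sk.
Qed.

(** At a B-smoothed crossing the level rises by one and the term is [G k - G k.+1]; at the other
    crossings neither the level nor the circle changes. The two ends of the telescope lie on the
    same circle by [circle_top_bot]. *)
Lemma alternating_column_sum S l (C : {set dart D}) :
  two_negative -> good S -> 0 < a l -> C \in circles S ->
  \sum_(k < height l | at_col k \in S)
    (-1) ^+ level S l k * (touches (at_col k) C)%:R =
  (1 - (-1) ^+ csize S l) * (C == circle S (node false l 0))%:R :> int.
Proof.
move=> neg2 goodS al SC.
pose G m : int := (-1) ^+ level S l m * (C == circle S (node false l m))%:R.
transitivity (\sum_(0 <= k < height l) (- G k.+1 - - G k)).
  rewrite big_mkord big_mkcond; apply: eq_bigr => k _; rewrite /G levelS.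
  case: ifP => Sk.
    by rewrite (touches_good neg2 goodS al Sk SC) addn1 exprS; ring.
  rewrite addn0 (circle_vertical false (k := k)); first by ring.
  by rewrite vertical_col al Sk.
rewrite telescope_sumr // /G level0 -circle_top_bot //.
  by rewrite /csize; ring.
by case: neg2 => j [_ [_ aj _]]; exists j.
Qed.

Lemma big_crossing (R : Type) (idx : R) (op : Monoid.com_law idx)
    (F : crossing D -> R) (P : pred (crossing D)) :
  \big[op/idx]_(i | P i) F i =
  \big[op/idx]_l \big[op/idx]_(k < height l | P (at_col k)) F (at_col k).
Proof.
rewrite (sig_big_dep xpredT (fun l (k : 'I_(height l)) => P (at_col k))
  (fun l (k : 'I_(height l)) => F (at_col k))) /=.
by apply: eq_big => -[l k].
Qed.

Lemma csizeD1 S l l' (k : 'I_(height l)) : at_col k \in S ->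
  csize S l' = (csize (S :\ at_col k) l' + (l' == l))%N.
Proof.
move=> Sk; rewrite !csizeE; have [ll'|ll'] := eqVneq l' l.
  subst l'; rewrite (bigD1 k) //= Sk [in RHS](bigD1 k) //= setD11 add0n addnC.
  congr (_ + _)%N; apply: eq_bigr => j jk; rewrite !inE.
  by rewrite (_ : at_col j != at_col k) //; apply: contraNneq jk => /eqP;
    rewrite eq_Tagged.
rewrite addn0; apply: eq_bigr => j _; rewrite !inE.
rewrite (_ : at_col j != at_col k) //.
by apply: contraNneq ll' => /(congr1 (@tag _ _)) /= ->.
Qed.

(** The crossings that precede [at_col k] are those of the columns of smaller index and those above
    it; the first factor is constant along the column. *)
Lemma edge_sign_col S l (k : 'I_(height l)) :
  edge_sign (S :\ at_col k) (at_col k) =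
  (-1) ^+ (\sum_(l' < n | (l' < l)%N) csize S l') * (-1) ^+ level S l k.
Proof.
rewrite /edge_sign -exprD; congr (_ ^+ _).
pose A := [set j in S :\ at_col k | (enum_rank j < enum_rank (at_col k))%N].
have in_A l' (k' : 'I_(height l')) : (at_col k' \in A) = (at_col k' \in S) &&
    ((l' < l)%N || (l' == l) && (k' < k)%N).
  rewrite !inE (enum_rank_lex (m := fun l => height l)) /lex_lt /=.
  rewrite -andbA andbCA; congr (_ && _); apply/andb_idl; apply: contraTneq.
  move=> e; have e_col := congr1 (fun i : crossing D => tag i : nat) e.
  have e_row := congr1 (fun i : crossing D => tagged i : nat) e.
  by rewrite /= in e_col e_row; rewrite e_col e_row !ltnn andbF.
rewrite -/A -sum1_card [LHS]big_crossing.
rewrite (bigID (fun l' : 'I_n => l' < l)%N) /=; congr (_ + _)%N.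
  apply: eq_bigr => l' l'l; rewrite csizeE -big_mkcond /=.
  by apply: eq_bigl => k'; rewrite in_A l'l andbT.
rewrite (bigD1 l) ?ltnn //= [X in (_ + X)%N]big1 ?addn0.
  rewrite /level -big_mkcondr /=; apply: eq_bigl => k'.
  by rewrite in_A ltnn eqxx andbC.
move=> l' /andP[l'l ne].
by rewrite big_pred0 // => k'; rewrite in_A (negPf l'l) (negPf ne) andbF.
Qed.

(** * Sums of states with prescribed column sizes, and their differentials *)

Definition sized (r : 'I_n -> nat) : {set {set crossing D}} :=
  [set S | [forall l, csize S l == r l]].

Definition bump (r : 'I_n -> nat) l : 'I_n -> nat :=
  fun l' => (r l' + (l' == l))%N.

Lemma sizedP (r : 'I_n -> nat) S :
  reflect (forall l, csize S l = r l) (S \in sized r).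
Proof. by rewrite inE; apply: (iffP forallP) => rS l; apply/eqP. Qed.

Lemma sizedD1 (r : 'I_n -> nat) S l (k : 'I_(height l)) : at_col k \in S ->
  (S :\ at_col k \in sized r) = (S \in sized (bump r l)).
Proof.
move=> Sk; apply/sizedP/sizedP => rS l'; first by rewrite (csizeD1 l' Sk) rS.
by have := rS l'; rewrite (csizeD1 l' Sk) => /addIn.
Qed.

(** These bounds make every state with the sizes [r] good. *)
Definition admissible (r : 'I_n -> nat) := forall l,
  if 0 < a l then (1 < r l <= height l)%N else r l == height l.

Lemma csize_full S l (k : 'I_(height l)) :
  csize S l = height l -> at_col k \in S.
Proof.
move=> Sl; have := leq_csize (at_col k |: S) l; apply: contraTT => Sk.
by rewrite (csizeD1 l (setU11 _ _)) eqxx setU1K // Sl addn1 ltnn.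
Qed.

Lemma csize_sub S0 S l : S0 \subset S -> (csize S0 l <= csize S l)%N.
Proof.
move=> /subsetP S0S; rewrite !csizeE; apply: leq_sum => k _.
by case S0k : (at_col k \in S0); rewrite // (S0S _ S0k).
Qed.

Lemma good_sub S0 S : S0 \subset S -> good S0 -> good S.
Proof.
move=> S0S [posS0 negS0]; split=> [l al|l k al].
  exact: leq_trans (posS0 l al) (csize_sub l S0S).
exact: (subsetP S0S) (negS0 l k al).
Qed.

Lemma good_sized (r : 'I_n -> nat) S : admissible r -> S \in sized r -> good S.
Proof.
move=> adm /sizedP rS; split=> [l al|l k al].
  by have := adm l; rewrite al rS => /andP[].
by apply: csize_full; rewrite rS; have := adm l; rewrite (negPf al) => /eqP.
Qed.

(** Only a column that is not yet full can be bumped, hence a positive one; there the signs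
    alternate with the level. *)
Lemma boundary_coefficient (r : 'I_n -> nat) S (C : {set dart D}) :
  two_negative -> good S -> admissible r -> C \in circles S ->
  \sum_(i in S | S :\ i \in sized r) edge_sign (S :\ i) i * (touches i C)%:R =
  \sum_(l | S \in sized (bump r l))
    (-1) ^+ (\sum_(l' < n | (l' < l)%N) csize S l') *
    ((1 - (-1) ^+ csize S l) * (C == circle S (node false l 0))%:R).
Proof.
move=> neg2 goodS adm SC; rewrite big_crossing [RHS]big_mkcond.
apply: eq_bigr => l _ /=.
case: ifP => Sr; last first.
  by rewrite big_pred0 // => k; apply/andP => -[Sk]; rewrite sizedD1 // Sr.
have al : 0 < a l.
  apply: contraT => al; have := adm l; rewrite (negPf al) => /eqP rl.
  move/sizedP/(_ l): Sr; rewrite /bump eqxx rl addn1 => Sl.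
  by have := leq_csize S l; rewrite Sl ltnn.
rewrite -alternating_column_sum // big_distrr /=.
apply: eq_big => [k|k /andP[Sk _]].
  by apply: andb_idr => Sk; rewrite sizedD1.
by rewrite edge_sign_col mulrA.
Qed.

(** An odd size becomes even when bumped, and a full column cannot be bumped. *)
Lemma bump_odd (r : 'I_n -> nat) S l : S \in sized (bump r l) ->
  odd (r l) || (r l == height l) -> 1 - (-1) ^+ csize S l = 0 :> int.
Proof.
move=> /sizedP/(_ l) Sl; rewrite Sl /bump eqxx addn1 => /orP[rl|/eqP rl].
  by rewrite exprS -signr_odd rl; ring.
by have := leq_csize S l; rewrite Sl /bump eqxx rl addn1 ltnn.
Qed.

Lemma differential_good (r : 'I_n -> nat) K t : admissible r ->
  differential (marked_sum (sized r) K) t != 0 -> good (Bset t).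
Proof.
move=> adm nz; have : [exists i, Bset t :\ i \in sized r].
  apply: contraNT nz => /existsPn none; rewrite differential_marked_sum.
  by rewrite big_pred0 // => i; rewrite (negPf (none i)) andbF.
by case/existsP=> i /(good_sized adm); apply: good_sub (subsetDl _ _).
Qed.

Lemma sized_cycle (r : 'I_n -> nat) K : two_negative -> admissible r ->
  (forall l, odd (r l) || (r l == height l)) ->
  differential (marked_sum (sized r) K) = 0.
Proof.
move=> neg2 adm r_odd; apply/ffunP => t; rewrite [RHS]ffunE.
have [//|nz] := eqVneq (differential (marked_sum (sized r) K) t) 0.
have goodt := differential_good adm nz.
have spl := splitting_good neg2 goodt.
have [C [tC KC ->]] := differential_marked_sum_neq0 spl nz.
rewrite differential_marked_sumE // boundary_coefficient //.
by rewrite big1 // => l tl; rewrite (bump_odd tl) ?mul0r ?mulr0.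
Qed.

(** The column [l0] contributes [1 - (-1) ^+ r l0], which is 2; the other columns contribute 0 by
    [bump_odd]. *)
Lemma sized_boundary (r r' : 'I_n -> nat) l0 : two_negative ->
  admissible r -> admissible r' -> (forall l, r l = bump r' l0 l) ->
  (forall l, odd (r l) || (r l == height l)) -> odd (r l0) ->
  forall t, differential (marked_sum (sized r') None) t =
    (-1) ^+ (\sum_(l' < n | (l' < l0)%N) r l') *
    (marked_sum (sized r) (Some (node false l0 0)) t *+ 2).
Proof.
move=> neg2 adm adm' r_bump r_odd odd_l0 t.
have sized_r : sized (bump r' l0) = sized r.
  by apply/setP => S; rewrite !inE; apply: eq_forallb => l; rewrite r_bump.
set z := marked_sum (sized r) _.
have claim S C : good S -> C \in circles S ->
    differential (marked_sum (sized r') None) (state S [set C]) =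
    (-1) ^+ (\sum_(l' < n | (l' < l0)%N) r l') * (z (state S [set C]) *+ 2).
  move=> goodS SC; have spl := splitting_good neg2 goodS.
  rewrite -[[set C]]setU0.
  rewrite (@differential_marked_sumE D (sized r') None S C) // ?inE //.
  rewrite boundary_coefficient // setU0 marked_sum1 //.
  have others l : l != l0 -> S \in sized (bump r' l) ->
      1 - (-1) ^+ csize S l = 0 :> int.
    move=> ll0 Sl; apply: bump_odd Sl _.
    by have := r_odd l; rewrite r_bump /bump (negPf ll0) addn0.
  have [Sr|Sr] := boolP (S \in sized r); last first.
    rewrite big1 ?mul0rn ?mulr0 // => l Sl.
    rewrite others ?mul0r ?mulr0 //.
    by apply: contraNneq Sr => ll0; rewrite -sized_r -ll0.
  rewrite (bigD1 l0) ?sized_r //=.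
  rewrite [X in _ + X]big1 ?addr0 => [|l /andP[Sl ll0]]; last first.
    by rewrite others // mul0r mulr0.
  have rS := sizedP _ _ Sr; rewrite rS -(signr_odd _ (r l0)) odd_l0.
  by under eq_bigr do rewrite rS; congr (_ * _); ring.
(* Where the differential vanishes, [claim] still covers the support of [z], and off it both sides
   are zero. *)
have [w0|nz] := eqVneq (differential (marked_sum (sized r') None) t) 0.
  have [/andP[tr /eqP ->]|nt] := boolP ((Bset t \in sized r) &&
      (t == state (Bset t) (marked (Bset t) (Some (node false l0 0))))).
    exact: claim (good_sized adm tr) (mem_circles _ (node false l0 0)).
  by rewrite w0 ffunE (negPf nt) mul0rn mulr0.
have goodt := differential_good adm' nz.
have spl := splitting_good neg2 goodt.
have [C [tC _ tE]] := differential_marked_sum_neq0 spl nz.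
by rewrite setU0 in tE; rewrite tE; apply: claim.
Qed.

(** * Bidegrees and torsion cycles *)

Lemma card_sized (r : 'I_n -> nat) S : S \in sized r ->
  #|S| = (\sum_(l < n) r l)%N.
Proof.
move=> /sizedP rS; rewrite -sum1_card [LHS]big_crossing.
by apply: eq_bigr => l _; rewrite -rS csizeE -big_mkcond.
Qed.

(** All the states between [S] and the all-B state are splitting, so the number of B-smoothings
    determines the number of circles. *)
Lemma bidegree_sized (o : orientation D) (r : 'I_n -> nat) K S :
  two_negative -> admissible r -> S \in sized r ->
  let N := (\sum_(l < n) r l)%N in
  bidegree o (state S (marked S K)) =
  (N%:Z - (n_minus o)%:Z,
   (#|circles [set: crossing D]| + N)%N%:Z - #|crossing D|%:Z - K%:Z *+ 2 + N%:Z
     + (n_plus o)%:Z - (n_minus o)%:Z *+ 2).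
Proof.
move=> neg2 adm Sr N; rewrite /bidegree label_degree_marked Bset_state.
have := @card_circles_splitting D S [set: crossing D] (subsetT S).
rewrite cardsT (card_sized Sr) -/N => -> ; last first.
  by move=> S1 SS1 _; apply/(splitting_good neg2)/(good_sub SS1)/(good_sized adm).
by congr (_, _); lia.
Qed.

(** A representative of the states with the sizes [r], at which the functional modulo 2 is
    evaluated. *)
Definition top_state (r : 'I_n -> nat) : {set crossing D} :=
  [set i : crossing D | (tagged i < r (tag i))%N].

Lemma top_state_sized (r : 'I_n -> nat) :
  admissible r -> top_state r \in sized r.
Proof.
move=> adm; apply/sizedP => l.
have le_r : (r l <= height l)%N.
  by have := adm l; case: ifP => _; [case/andP | move=> /eqP->].
rewrite csizeE -[RHS]card_ord -sum1_card (big_ord_widen _ (fun=> 1%N) le_r).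
by rewrite [RHS]big_mkcond; apply: eq_bigr => k _; rewrite inE; case: ifP.
Qed.

Lemma differentialN (f : chain D) : differential (- f) = - differential f.
Proof. by rewrite -[- f]sub0r differentialB differential0 sub0r. Qed.

Definition torsion_chain (r : 'I_n -> nat) l : chain D :=
  marked_sum (sized r) (Some (node false l 0)).

Lemma torsion_chain_half (o : orientation D) (r : 'I_n -> nat) l0 :
  two_negative -> admissible r -> 0 < a l0 -> odd (r l0) ->
  (forall l, odd (r l) || (r l == height l)) ->
  exists (hq : int * int) (w : chain D),
    [/\ torsion_chain r l0 \in is_cycle o hq.1 hq.2,
        w \in homogeneous o (hq.1 - 1) hq.2 &
        differential w = torsion_chain r l0 *+ 2].
Proof.
move=> neg2 adm al0 odd_l0 r_odd.
have := adm l0; rewrite al0 => /andP[gt1 le_h].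
pose r' l := (r l - (l == l0))%N.
have r_bump l : r l = bump r' l0 l.
  by rewrite /bump /r' subnK //; case: eqP => // ->; apply: ltnW.
(* An odd [r l0] greater than 1 is at least 3, so two B-smoothings remain after the lowering. *)
have adm' : admissible r'.
  move=> l; have := adm l; rewrite /r'.
  have [->|ll0] := eqVneq l l0; last by rewrite subn0.
  by rewrite al0; move: (r l0) odd_l0 => [|[|[|m]]] //=; lia.
have sum_r : (\sum_(l < n) r l = (\sum_(l < n) r' l).+1)%N.
  under eq_bigr do rewrite r_bump /bump.
  rewrite big_split /= -addn1; congr (_ + _)%N.
  by rewrite -big_mkcond /= big_pred1_eq.
have S0r := top_state_sized adm; move: (top_state r) S0r => S0 S0r.
pose hq := bidegree o (state S0 (marked S0 (Some (node false l0 0)))).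
pose w0 := marked_sum (sized r') None.
have w0_hom : w0 \in homogeneous o (hq.1 - 1) hq.2.
  apply: marked_sum_homogeneous => S Sr'.
  rewrite (bidegree_sized o _ neg2 adm' Sr').
  rewrite /hq (bidegree_sized o _ neg2 adm S0r) /= sum_r.
  by move: (\sum_(l < n) r' l)%N => N; congr (_, _); rewrite ?mulr2n; lia.
have z_cycle : torsion_chain r l0 \in is_cycle o hq.1 hq.2.
  apply/andP; split; last by rewrite sized_cycle.
  apply: marked_sum_homogeneous => S Sr.
  by rewrite -surjective_pairing /hq !(bidegree_sized o _ neg2 adm).
have dw0 := sized_boundary neg2 adm adm' r_bump r_odd odd_l0.
pose s := (\sum_(l' < n | (l' < l0)%N) r l')%N.
(* The sign found in [sized_boundary] is absorbed into [w]. *)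
exists hq, (if odd s then - w0 else w0); split=> //.
  case: ifP => // _; apply/forallP => t; rewrite ffunE oppr_eq0.
  exact: (forallP w0_hom).
apply/ffunP => t; have := dw0 t; rewrite -signr_odd -/s.
case: (odd s) => /= [dt|->]; last by rewrite mul1r mulr2n !ffunE.
by rewrite differentialN ffunE dt mulr2n !ffunE; ring.
Qed.

(** Exactly one circle of the state passes through the marked dart, whatever the column [l]. *)
Lemma torsion_chain_one_x (r r' : 'I_n -> nat) l :
  \sum_(C in circles (top_state r))
    torsion_chain r' l (state (top_state r) [set C]) =
  (top_state r \in sized r')%:R.
Proof.
set S := top_state r.
under eq_bigr => C SC do rewrite marked_sum1 //.
rewrite (bigD1 (circle S (node false l 0))) ?mem_circles //= eqxx andbT.
by rewrite big1 ?addr0 // => C /andP[_ /negPf->]; rewrite andbF.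
Qed.

End PretzelStates.

(** * Choosing and counting the column sizes *)

Theorem corollary17 (n : nat) (a : 'I_n -> int) (o : orientation (pretzel a))
  (a_neq0 : forall l : 'I_n, a l <> 0)
  (a_neq1 : forall l : 'I_n, a l <> 1)
  (a_ge3 : exists i : 'I_n, 3 <= a i)
  (a_neg : exists j k : 'I_n, [/\ j <> k, a j < 0 & a k < 0]) :
  exists T : 'I_(\prod_(l < n | (0 < a l)%R) (`|a l| %/ 2) - 1)%N ->
             {hq : int * int & set (Kh o hq.1 hq.2)},
    injective T /\ forall m, is_Z2_subgroup (projT2 (T m)).
Proof.
have heightE l : `|a l|.-1.+1 = `|a l|%N by have := a_neq0 l; lia.
(* The number of sizes offered to each column; a negative column has only its full size. *)
pose b l : nat := if 0 < a l then (`|a l| %/ 2)%N else 1%N.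
have b_gt0 l : (0 < b l)%N.
  by rewrite /b; have := a_neq1 l; case: ifP; lia.
pose B := (\max_l `|a l|)%N.
have b_le l : (b l <= B)%N.
  apply: leq_trans (leq_bigmax l); rewrite /b.
  by have := a_neq0 l; case: ifP; lia.
pose F := family (fun l : 'I_n => [pred c : 'I_B.+1 | (c < b l)%N]).
have cardF : #|F| = (\prod_(l < n | (0 < a l)%R) (`|a l| %/ 2))%N.
  rewrite /F card_family foldrE big_map big_enum /= big_mkcond.
  rewrite [RHS]big_mkcond; apply: eq_bigr => l _ /=; rewrite -[RHS]/(b l).
  rewrite -sum1_card -(big_ord_widen _ (fun=> 1%N)) ?sum1_card ?card_ord //.
  exact: leqW.
(* The choice r = a, possibly without odd entries. *)
pose last : {ffun 'I_n -> 'I_B.+1} := [ffun l => inord (b l).-1].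
have val_last l : last l = (b l).-1 :> nat.
  by rewrite ffunE inordK // prednK // leqW.
have lastF : last \in F.
  by apply/familyP => l; rewrite inE val_last prednK.
pose A := [predD1 F & last].
have cardA : #|A| = (\prod_(l < n | (0 < a l)%R) (`|a l| %/ 2) - 1)%N.
  by rewrite -cardF (cardD1 last F) lastF addKn.
rewrite -cardA.
(* In a positive column the choice [(b l).-1] gives [a l] whatever its parity, and the smaller
   choices give the odd numbers from 3 on that lie below it. *)
pose r (c : {ffun 'I_n -> 'I_B.+1}) l : nat :=
  if 0 < a l then minn (c l).*2.+3 `|a l| else `|a l|%N.
have F_lt (c : {ffun 'I_n -> 'I_B.+1}) l :
    c \in F -> (c l < b l)%N by move/familyP/(_ l).
have adm c : c \in F -> admissible a (r c).
  move=> cF l; rewrite heightE /r; have := F_lt c l cF; rewrite /b.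
  by case: ifP => // al; lia.
have r_odd c : c \in F -> forall l, odd (r c l) || (r c l == `|a l|.-1.+1).
  move=> cF l; rewrite heightE /r; case: ifP => _; last by rewrite eqxx orbT.
  by rewrite minnE; lia.
(* Some [c l] is not maximal; since [b l] is 1 on negative columns, this column is positive and its
   size is the odd number [(c l).*2.+3]. *)
have exists_odd c : c \in A -> exists l, 0 < a l /\ odd (r c l).
  move=> /andP[c_last cF].
  have [l cl] : exists l, c l != last l.
    apply/existsP; apply: contraNT c_last => /existsPn eq_c.
    by apply/eqP/ffunP => l; apply/eqP; have := eq_c l; rewrite negbK.
  exists l; have := F_lt c l cF; rewrite -val_eqE /= val_last in cl.
  by rewrite /r; move: cl; rewrite /b; case: ifP => //; lia.
have r_inj c c' : c \in F -> c' \in F -> (forall l, r c l = r c' l) -> c = c'.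
  move=> cF c'F eq_r; apply/ffunP => l; apply/val_inj => /=.
  have := eq_r l; have := F_lt c l cF; have := F_lt c' l c'F.
  by rewrite /r /b; case: ifP; lia.
have inF (m : 'I_#|A|) : enum_val m \in F by have /andP[] := enum_valP m.
have /boolp.choice[x xP] (m : 'I_#|A|) :
    exists x : 'I_n * (int * int) * chain (pretzel a),
      [/\ torsion_chain a (r (enum_val m)) x.1.1 \in
             is_cycle o x.1.2.1 x.1.2.2,
          x.2 \in homogeneous o (x.1.2.1 - 1) x.1.2.2 &
          differential x.2 = torsion_chain a (r (enum_val m)) x.1.1 *+ 2].
  have [l [al odd_l]] := exists_odd _ (enum_valP m).
  have [hq [w [zP wP dw]]] :=
    torsion_chain_half o a_neg (adm _ (inF m)) al odd_l (r_odd _ (inF m)).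
  by exists (l, hq, w).
apply: (@torsion_family _ o _ (fun m => (x m).1.2) (fun m => (x m).2)
  (fun m => torsion_chain a (r (enum_val m)) (x m).1.1)
  (fun m => top_state a (r (enum_val m)))) => [m|m|m|m|m m'].
- by have [] := xP m.
- by have [] := xP m.
- by have [] := xP m.
- apply: splitting_good a_neg _; apply: good_sized (adm _ (inF m)) _.
  exact: top_state_sized (adm _ (inF m)).
(* Duality: the representative for [m] has the sizes of [m'] only if the two size vectors agree, and
   [r] is injective on [F]. *)
- rewrite torsion_chain_one_x.
  congr (_%:R); congr nat_of_bool.
  have /sizedP rm := top_state_sized (adm _ (inF m)).
  apply/idP/eqP => [/sizedP rm'|<-]; last exact: top_state_sized (adm _ (inF m)).
  by apply/enum_val_inj/r_inj => // l; rewrite -rm rm'.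
Qed.
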